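(* Let $X$ be a Polish space and let $f:X\to\omega^\omega$ be a Baire class 1 function which is not piecewise continuous. Then the forcing $\mathbb{P}_{\mathcal{I}^f}$ is equivalent to the Miller forcing.
   Context: $f$ is piecewise continuous if $X$ can be covered by countably many closed sets on each of which $f$ is continuous. $\mathcal{I}^f$ is the $\sigma$-ideal on $X$ generated by the closed sets on which $f$ is continuous, i.e. the family of all sets covered by countably many closed sets $C$ such that $f\upharpoonright C$ is continuous. For a $\sigma$-ideal $\mathcal{I}$ on $X$, $\mathbb{P}_{\mathcal{I}}$ is the poset of Borel subsets of $X$ not in $\mathcal{I}$, ordered by inclusion. The Miller forcing is the forcing with superperfect trees, equivalently $\mathbb{P}_{\mathbf{K}_\sigma}$, where $\mathbf{K}_\sigma$ is the $\sigma$-ideal of subsets of $\omega^\omega$ that can be covered by countably many compact sets. Two forcing notions are equivalent if they yield the same generic extensions (isomorphic Boolean completions). *)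

(* Defs.v *)
From mathcomp Require Import all_boot all_order all_algebra.
From mathcomp Require Import all_classical all_reals all_analysis.
From mathcomp Require Import borel_hierarchy.

Set Implicit Arguments.
Unset Strict Implicit.
Unset Printing Implicit Defensive.

Import Order.TTheory.
Local Open Scope classical_set_scope.

Notation baire_space := (prod_topology (fun _ : nat => nat)).

Definition separable (X : topologicalType) : Prop :=
  exists2 D : set X, countable D & dense D.

Definition completely_metrizable (R : realType) (X : topologicalType) : Prop :=
  exists (M : metricType R) (h : X -> M) (g : M -> X),
    [/\ cancel h g, cancel g h, continuous h, continuous g
      & forall F : set_system M, ProperFilter F -> cauchy F ->
        exists x : M, F --> x].

Definition polish (R : realType) (X : topologicalType) : Prop :=
  separable X /\ completely_metrizable R X.

Section functions.
Variables X Y : topologicalType.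
Implicit Type f : X -> Y.

(* Being a pointwise limit of continuous functions is not the right definition
   for maps into baire_space: when X is connected, the continuous ones are the
   constants. *)
Definition baire_class1 f : Prop :=
  forall U : set Y, open U -> Fsigma (f @^-1` U).

Definition closed_continuity_set f : set (set X) :=
  [set C | closed C /\ {within C, continuous f}].

(* The sigma-ideal generated by the closed sets of continuity. A sequence is as
   good as a countable family here, as set0 is a closed set of continuity. *)
Definition continuity_ideal f : set (set X) :=
  [set A | exists2 C : (set X)^nat,
     (forall n, closed_continuity_set f (C n)) & A `<=` \bigcup_n C n].

Definition piecewise_continuous f : Prop :=
  exists2 C : (set X)^nat,
    (forall n, closed_continuity_set f (C n)) & \bigcup_n C n = setT.

End functions.

(* A forcing notion is a set P of conditions in a partial order, with the
   induced order; smaller conditions are stronger. Sets are ordered by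
   inclusion through the library's order on set T. *)
Section forcing.
Local Open Scope order_scope.

(* The Boolean completion of P, realized as the complete Boolean algebra of
   regular open subsets for the topology whose open sets are the down-closed
   subsets of P. For such U, the interior of the closure of U is the set of p
   below which U is dense. *)
Definition boolean_completion d (T : porderType d) (P : set T) : set (set T) :=
  [set U | [/\ (U `<=` P)%classic,
     (forall p q, U p -> P q -> q <= p -> U q) &
     (forall p, P p ->
        (forall q, P q -> q <= p -> exists2 r, U r & r <= q) -> U p)]].

(* An isomorphism of Boolean algebras is the same as an order isomorphism, and
   the order on regular open sets is inclusion. *)
Definition forcing_equivalent d d' (T : porderType d) (T' : porderType d')
    (P : set T) (Q : set T') : Prop :=
  exists2 F : set T -> set T',
    set_bij (boolean_completion P) (boolean_completion Q) F
    & forall U V, boolean_completion P U -> boolean_completion P V ->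
        (U `<=` V)%classic <-> (F U `<=` F V)%classic.

End forcing.

Definition ideal_forcing (X : topologicalType) (I : set (set X)) :
    set (set X) :=
  [set B | <<s @open X >> B /\ ~ I B].

Definition superperfect_tree (T : set (seq nat)) : Prop :=
  [/\ T !=set0,
      (forall s t, prefix s t -> T t -> T s) &
      (forall s, T s -> exists t,
         [/\ prefix s t, T t & infinite_set [set n | T (rcons t n)]])].

Definition miller_forcing : set (set (seq nat)) :=
  [set T | superperfect_tree T].

(* Main.v *)
Require Import Defs.
From mathcomp Require Import all_boot all_order all_algebra.
From mathcomp Require Import all_classical all_reals all_analysis.
From mathcomp Require Import zify.

(** Let the graph topology on [X] be the one that makes the map from [X] to the
    graph of [f] a homeomorphism. It refines the topology of [X], and a closed set
    is a set of continuity of [f] exactly when the two topologies agree on it.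

    Suppose that a copy [D] of the Baire space is closed in [X] for the graph
    topology and has a compact closure for the original one. A closed set of
    continuity meets that closure in a set that is compact for both topologies, so
    it meets [D] in a compact subset of the Baire space; conversely a compact
    subset of [D] is a closed set of continuity. So the ideal of [f], restricted
    to [D], is the sigma-ideal generated by the compact sets of the Baire space,
    and the images in [D] of bodies of superperfect trees are dense below [D].

    Such a copy exists inside each Borel set [B] outside the ideal. As [f] is of
    Baire class 1, [B] is the image of a closed set of sequences under a map that
    is continuous for the graph topology ([parametrized_measurable]). An image that
    is not in the ideal has, in its closure, a point at which it is approached by
    points whose values under [f] stay away from the value at the limit
    ([not_small_discontinuity]). Iterating this along a tree produces a copy
    ([scheme_embedding]) in which the [n]-th successor cones of a node converge to
    such a point. Closedness of the copy for the graph topology and compactness of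
    its closure both follow from this.

    It remains to pass from this local description to a global one. A maximal
    antichain of copies has at most continuum many members, since a copy is coded
    by an element of the Cantor space ([code]). Miller forcing contains continuum
    many pairwise incompatible copies of itself, one for each code ([tint]). So a
    dense subset of the forcing of [f] embeds onto a down-closed subset of Miller
    forcing; and Miller forcing embeds onto the part of that dense subset below a
    single member of the antichain. A Schroeder-Bernstein argument
    ([cantor_bernstein_equivalent]) then matches dense subsets of the two
    forcings, which therefore have isomorphic completions. *)

Set Implicit Arguments.
Unset Strict Implicit.
Unset Printing Implicit Defensive.

Import Order.TTheory GRing.Theory Num.Theory.
Local Open Scope classical_set_scope.

(** * Dense isomorphisms and equivalence of forcings *)

Section DenseIsomorphism.
Context (d d' : Order.disp_t) (T : porderType d) (T' : porderType d').
Implicit Types (P : set T) (Q : set T') (D : set (T * T')).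

(** A relation is used rather than a map because the dense subsets to be matched
    are glued from two pieces that carry isomorphisms in opposite directions. *)
Definition dense_isomorphism P Q D :=
  [/\ (forall p q, D (p, q) -> P p /\ Q q),
      (forall p, P p -> exists p' q', D (p', q') /\ (p' <= p)%O),
      (forall q, Q q -> exists p' q', D (p', q') /\ (q' <= q)%O) &
      (forall p q p' q', D (p, q) -> D (p', q') ->
         (p <= p')%O <-> (q <= q')%O)].

(** A regular open set is determined by its members in a dense subset, so it can
    be carried across [D] and then completed on the other side. *)
Definition transfer D Q (U : set T) : set T' :=
  [set q | Q q /\ forall a b, D (a, b) -> (b <= q)%O -> U a].

Lemma transfer_completion P Q D U : dense_isomorphism P Q D ->
  boolean_completion P U -> boolean_completion Q (transfer D Q U).
Proof.
case=> DPQ denseP denseQ DD [UP Udown Ureg]; split.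
- by move=> q [].
- move=> q q' [Qq Uq] Qq' q'q; split=> // a b Dab bq'.
  exact: (Uq a b Dab (le_trans bq' q'q)).
- move=> q Qq dense_q; split=> // a b Dab bq.
  have [Pa Qb] := DPQ _ _ Dab.
  apply: Ureg => // p Pp pa.
  have [a' [b' [Dab' a'p]]] := denseP p Pp.
  have [Pa' Qb'] := DPQ _ _ Dab'.
  have b'b : (b' <= b)%O by apply/(DD _ _ _ _ Dab' Dab); apply: le_trans a'p pa.
  have [r [Qr Ur] rb'] := dense_q b' Qb' (le_trans b'b bq).
  have [a'' [b'' [Dab'' b''r]]] := denseQ r Qr.
  exists a''; first exact: (Ur _ _ Dab'' b''r).
  apply: le_trans a'p; apply/(DD _ _ _ _ Dab'' Dab').
  exact: le_trans b''r rb'.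
Qed.

End DenseIsomorphism.

Definition converse (A B : Type) (D : set (A * B)) : set (B * A) :=
  [set ba | D (ba.2, ba.1)].

Lemma converseK (A B : Type) (D : set (A * B)) : converse (converse D) = D.
Proof. by apply/seteqP; split=> -[]. Qed.

Lemma dense_isomorphismC d d' (T : porderType d) (T' : porderType d')
    (P : set T) (Q : set T') D :
  dense_isomorphism P Q D -> dense_isomorphism Q P (converse D).
Proof.
case=> DPQ denseP denseQ DD; split.
- by move=> q p /DPQ[].
- by move=> q /denseQ[a [b [Dab bq]]]; exists b, a.
- by move=> p /denseP[a [b [Dab ap]]]; exists b, a.
- by move=> p q p' q' Dqp Dq'p'; rewrite (DD _ _ _ _ Dqp Dq'p').
Qed.

Lemma transferK d d' (T : porderType d) (T' : porderType d')
    (P : set T) (Q : set T') D U :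
  dense_isomorphism P Q D -> boolean_completion P U ->
  transfer (converse D) P (transfer D Q U) = U.
Proof.
case=> DPQ denseP denseQ DD [UP Udown Ureg]; apply/seteqP; split=> p.
- case=> Pp dense_p; apply: Ureg => // p' Pp' p'p.
  have [a [b [Dab ap']]] := denseP p' Pp'.
  exists a => //.
  by have [_ /(_ a b Dab (lexx _))] := dense_p b a Dab (le_trans ap' p'p).
- move=> Up; split; first exact: UP.
  move=> b a /= Dab ap; have [Pa Qb] := DPQ _ _ Dab; split=> // a' b' Dab' b'b.
  have [Pa' Qb'] := DPQ _ _ Dab'.
  apply: (Udown p) => //; apply: le_trans ap.
  exact/(DD _ _ _ _ Dab' Dab).
Qed.

Lemma dense_isomorphism_equivalent d d' (T : porderType d) (T' : porderType d')
    (P : set T) (Q : set T') D :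
  dense_isomorphism P Q D -> forcing_equivalent P Q.
Proof.
move=> isoD; have isoD' := dense_isomorphismC isoD.
exists (transfer D Q).
  split.
  - by move=> U; apply: transfer_completion.
  - move=> U V; rewrite !inE => PU PV eqUV.
    by rewrite -(transferK isoD PU) eqUV transferK.
  - move=> V QV; exists (transfer (converse D) P V).
      exact: transfer_completion QV.
    by have := transferK isoD' QV; rewrite converseK.
move=> U V PU PV; split=> UV.
  by move=> q [Qq Uq]; split=> // a b Dab bq; apply: UV; apply: Uq bq.
rewrite -(transferK isoD PU) -(transferK isoD PV) => p [Pp dense_p].
by split=> // a b Dab bp; apply: UV; apply: dense_p bp.
Qed.

(** A Schroeder-Bernstein argument for forcings: [W] indexes a dense subset of
    [P] through [e], [i] embeds that subset onto a down-closed part of [Q], and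
    [j] embeds [Q] onto a down-closed part of that subset. As in the
    set-theoretic proof one uses [i] on some conditions and the inverse of [j]
    on the others; down-closure of the ranges makes the two kinds of conditions
    incompatible on either side, so that a condition of one kind is never below
    one of the other kind. *)
Section CantorBernstein.
Context (d d' : Order.disp_t) (T : porderType d) (T' : porderType d').
Context (P : set T) (Q : set T') (W : Type) (D : set W).
Context (e : W -> T) (i : W -> T') (j : T' -> W).
Hypothesis eP : forall w, D w -> P (e w).
Hypothesis e_dense : forall p, P p -> exists2 w, D w & (e w <= p)%O.
Hypothesis iQ : forall w, D w -> Q (i w).
Hypothesis jD : forall q, Q q -> D (j q).
Hypothesis i_le : forall w w', D w -> D w' -> (i w <= i w')%O <-> (e w <= e w')%O.
Hypothesis j_le : forall q q', Q q -> Q q' -> (e (j q) <= e (j q'))%O <-> (q <= q')%O.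
Hypothesis i_down :
  forall w q, D w -> Q q -> (q <= i w)%O -> exists2 w', D w' & q = i w'.
Hypothesis j_down :
  forall q w, Q q -> D w -> (e w <= e (j q))%O -> exists2 q', Q q' & w = j q'.

(** The conditions matched by [i]. Starting from the conditions without any
    extension in the range of [j], rather than from all those outside the range,
    makes the core down-closed. *)
Inductive cb_core : W -> Prop :=
| cb_core_start w : D w ->
    (forall q, Q q -> ~ (e (j q) <= e w)%O) -> cb_core w
| cb_core_step w : cb_core w -> cb_core (j (i w)).

Let core_D w : cb_core w -> D w.
Proof. by elim=> {w} // w _ Dw; apply/jD/iQ. Qed.

Let core_down w w' : cb_core w -> D w' -> (e w' <= e w)%O -> cb_core w'.
Proof.
move=> Aw; elim: Aw w' => {w} [w Dw noj|w Aw IH] w' Dw' w'w.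
  apply: cb_core_start => // q Qq jqw'.
  exact: (noj q Qq (le_trans jqw' w'w)).
have Dw := core_D Aw; have Qiw := iQ Dw.
have [q Qq w'E] := j_down Qiw Dw' w'w; subst w'.
have qiw : (q <= i w)%O by apply/j_le.
have [w1 Dw1 qE] := i_down Dw Qq qiw; subst q.
by apply: cb_core_step; apply: IH => //; apply/i_le.
Qed.

Let core_j q : Q q -> cb_core (j q) -> exists2 w, cb_core w & q = i w.
Proof.
move=> Qq Ajq; move: {1 2}(j q) Ajq (erefl (j q)) => w0 [w Dw noj|w Aw] E.
  by case: (noj q Qq); rewrite E.
exists w => //; apply: le_anti; apply/andP.
have Qiw := iQ (core_D Aw).
by split; apply/j_le => //; rewrite E.
Qed.

(** The [q] matched with [j q]: those for which [j q] is incompatible with the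
    core. What lies in neither piece has extensions in one of them. *)
Definition cb_rest q := Q q /\ forall w, D w -> (e w <= e (j q))%O -> ~ cb_core w.

Definition cb_graph : set (T * T') :=
  [set pq | (exists w, [/\ cb_core w, pq.1 = e w & pq.2 = i w]) \/
            (cb_rest pq.2 /\ pq.1 = e (j pq.2))].

Lemma cb_graph_dense_isomorphism : dense_isomorphism P Q cb_graph.
Proof.
have core_rest w q : cb_core w -> cb_rest q ->
    ~ (e w <= e (j q))%O /\ ~ (i w <= q)%O.
  move=> Aw [Qq rest]; split=> [wq|wq].
    exact: (rest w (core_D Aw) wq).
  apply: (rest (j (i w))); first exact/jD/iQ/core_D.
    by apply/j_le => //; exact/iQ/core_D.
  exact: cb_core_step.
have rest_core w q : cb_core w -> cb_rest q ->
    ~ (e (j q) <= e w)%O /\ ~ (q <= i w)%O.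
  move=> Aw [Qq rest]; have Dw := core_D Aw; split=> [qw|qw].
    apply: (rest (j q)) => //; first exact: jD.
    by apply: core_down Aw _ qw; exact: jD.
  have [w1 Dw1 qE] := i_down Dw Qq qw; subst q.
  have w1w : (e w1 <= e w)%O by apply/i_le.
  apply: (rest (j (i w1))) => //; first exact: jD.
  exact/cb_core_step/(core_down Aw).
split.
- move=> p q [[w [Aw /= -> ->]]|[[/= Qq rest] ->]].
    by split; [apply: eP|apply: iQ]; exact: core_D.
  by split=> //; apply/eP/jD.
- move=> p Pp; have [w Dw wp] := e_dense Pp.
  have [[w' [Dw' w'w Aw']]|noA] :=
    pselect (exists w', [/\ D w', (e w' <= e w)%O & cb_core w']).
    exists (e w'), (i w'); split; last exact: le_trans w'w wp.
    by left; exists w'.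
  have [[q [Qq qw]]|noj] := pselect (exists q, Q q /\ (e (j q) <= e w)%O).
    exists (e (j q)), q; split; last exact: le_trans qw wp.
    right; split=> //; split=> // w' Dw' w'q Aw'.
    by apply: noA; exists w'; split=> //; apply: le_trans w'q qw.
  case: noA; exists w; split=> //; apply: cb_core_start => // q Qq qw.
  by apply: noj; exists q.
- move=> q Qq.
  have [[w [Aw wq]]|noA] := pselect (exists w, cb_core w /\ (i w <= q)%O).
    by exists (e w), (i w); split=> //; left; exists w.
  exists (e (j q)), q; split=> //; right; split=> //; split=> //= w Dw wq Aw.
  have [q' Qq' wE] := j_down Qq Dw wq; subst w.
  have [w Aw' q'E] := core_j Qq' Aw; subst q'.
  by apply: noA; exists w; split=> //; apply/j_le.
- move=> p q p' q' [[w [Aw /= -> ->]]|[Rq /= ->]]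
    [[w' [Aw' /= -> ->]]|[Rq' /= ->]].
  + by rewrite i_le //; exact: core_D.
  + by have [? ?] := core_rest _ _ Aw Rq'; split.
  + by have [? ?] := rest_core _ _ Aw' Rq; split.
  + by case: Rq Rq' => [Qq _] [Qq' _]; apply: j_le.
Qed.

Lemma cantor_bernstein_equivalent : forcing_equivalent P Q.
Proof. exact: dense_isomorphism_equivalent cb_graph_dense_isomorphism. Qed.

End CantorBernstein.

(** * Trees and finitely branching sets of sequences *)

(** Here and below [mkseq a k] is the initial segment of [a] of length [k]:
    two sequences agree up to [k] when these are equal, and [a] is in the basic
    clopen set of [s] when [mkseq a (size s) = s]. *)
Lemma agreeP k (a b : nat -> nat) :
  mkseq a k = mkseq b k <-> forall i, i < k -> a i = b i.
Proof.
split=> [ab i ik|ab].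
  by rewrite -(nth_mkseq 0 a ik) ab nth_mkseq.
apply: (@eq_from_nth _ 0); rewrite !size_mkseq // => i ik.
by rewrite !nth_mkseq // ab.
Qed.

Lemma agree_le k l (a b : nat -> nat) :
  k <= l -> mkseq a l = mkseq b l -> mkseq a k = mkseq b k.
Proof. by move=> kl /agreeP ab; apply/agreeP => i ik; apply/ab/(leq_trans ik). Qed.

Lemma take_mkseq k l (a : nat -> nat) : k <= l -> take k (mkseq a l) = mkseq a k.
Proof. by move=> kl; rewrite /mkseq -map_take take_iota (minn_idPl kl). Qed.

Lemma through_prefix (s t : seq nat) (a : nat -> nat) :
  prefix s t -> mkseq a (size t) = t -> mkseq a (size s) = s.
Proof.
move=> st at_; have := st; rewrite -at_ prefixE => /eqP.
by rewrite take_mkseq // size_prefix.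
Qed.

Lemma mkseq_prefix k l (a : nat -> nat) : k <= l -> prefix (mkseq a k) (mkseq a l).
Proof. by move=> kl; rewrite prefixE size_mkseq take_mkseq. Qed.

Lemma through_rcons (s : seq nat) n (a : nat -> nat) :
  mkseq a (size (rcons s n)) = rcons s n <->
  mkseq a (size s) = s /\ a (size s) = n.
Proof.
rewrite size_rcons mkseqS; split=> [/eqP|[-> ->] //].
by rewrite eqseq_rcons => /andP[/eqP ? /eqP ?].
Qed.

Lemma chain_limit (t : nat -> seq nat) :
  (forall n, prefix (t n) (t n.+1)) -> (forall n, n <= size (t n)) ->
  exists a : nat -> nat, forall n, mkseq a (size (t n)) = t n.
Proof.
move=> tS tsize.
have tle m n : m <= n -> prefix (t m) (t n).
  elim: n => [|n IH]; first by rewrite leqn0 => /eqP ->; exact: prefix_refl.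
  rewrite leq_eqVlt => /orP[/eqP ->|]; first exact: prefix_refl.
  by rewrite ltnS => /IH; move/prefix_trans; apply.
exists (fun i => nth 0 (t i.+1) i) => n.
apply: (@eq_from_nth _ 0); rewrite size_mkseq // => i ilt.
rewrite nth_mkseq //; have [le|/ltnW le] := leqP i.+1 n.
- have /prefixP[r ->] := tle _ _ le.
  by rewrite nth_cat (tsize i.+1).
- have /prefixP[r ->] := tle _ _ le.
  by rewrite nth_cat ilt.
Qed.

(** Closedness in the Baire space. *)
Definition closed_branches (E : set (nat -> nat)) :=
  forall a, (forall k, exists2 b, E b & mkseq b k = mkseq a k) -> E a.

(** The sets with compact closure. *)
Definition finitely_branching (A : set (nat -> nat)) :=
  forall s, exists N, forall n a, A a ->
    mkseq a (size (rcons s n)) = rcons s n -> n < N.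

(** The sigma-ideal generated by the compact sets. *)
Definition sigma_bounded (A : set (nat -> nat)) :=
  exists2 B : nat -> set (nat -> nat),
    (forall n, finitely_branching (B n)) & A `<=` \bigcup_n B n.

Lemma sigma_bounded_sub A B : A `<=` B -> sigma_bounded B -> sigma_bounded A.
Proof. by move=> AB [C fbC BC]; exists C => //; apply: subset_trans BC. Qed.

Lemma finitely_branching_sigma A : finitely_branching A -> sigma_bounded A.
Proof. by move=> fbA; exists (fun=> A) => // a Aa; exists 0. Qed.

Lemma sigma_bounded_bigcup (I : countType) (A : I -> set (nat -> nat)) :
  (forall i, sigma_bounded (A i)) -> sigma_bounded (\bigcup_i A i).
Proof.
move=> sA; have {sA} /choice[B sB] : forall i, exists B : nat -> set (nat -> nat),
    (forall n, finitely_branching (B n)) /\ A i `<=` \bigcup_n B n.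
  by move=> i; have [B] := sA i; exists B.
exists (fun n => if unpickle n is Some (i, m) then B i m else set0).
  move=> n; case: unpickle => [[i m]|]; first exact: (sB i).1.
  by move=> s; exists 0.
move=> a [i _ /(sB i).2[m _ Ba]]; exists (pickle (i, m)) => //.
by rewrite pickleK.
Qed.

(** Compactness: a sequence in a finitely branching set has a cluster point. *)
Lemma konig A (u : nat -> nat -> nat) :
  finitely_branching A -> (forall n, A (u n)) ->
  exists a, forall k N, exists2 n, N <= n & mkseq (u n) k = mkseq a k.
Proof.
move=> fbA Au.
pose often s := forall N, exists2 n, N <= n & mkseq (u n) (size s) = s.
have /choice[c oftenS] : forall s, exists m, often s -> often (rcons s m).
  move=> s; have [os|] := pselect (often s); last by exists 0.
  apply: contrapT => /forallNP no.
  have {no} /choice[N0 rare] : forall m, exists N, forall n, N <= n ->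
      mkseq (u n) (size (rcons s m)) <> rcons s m.
    move=> m; have /not_implyP[_ /existsNP[N noN]] := no m.
    by exists N => n Nn E; apply: noN; exists n.
  have [B Bs] := fbA s; have [n Nn us] := os (\max_(m < B) N0 m).
  have uE : mkseq (u n) (size (rcons s (u n (size s)))) = rcons s (u n (size s)).
    exact/through_rcons.
  have ltB := Bs _ _ (Au n) uE.
  apply: (rare (u n (size s)) n) => //; apply: leq_trans Nn.
  exact: (@leq_bigmax _ (fun m : 'I_B => N0 m) (Ordinal ltB)).
pose t n := iter n (fun s => rcons s (c s)) [::].
have ot n : often (t n) by elim: n => [|n IH]; [move=> N; exists N|apply: oftenS].
have st n : size (t n) = n by elim: n => //= n IH; rewrite size_rcons IH.
have [n|n|a ta] := @chain_limit t; [exact: prefix_rcons|by rewrite st|].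
exists a => k N; have [n Nn] := ot k N; rewrite st => uk.
by exists n => //; rewrite uk -(ta k) st.
Qed.

Lemma finite_set_bounded (S : set nat) :
  finite_set S -> exists N, forall n, S n -> n < N.
Proof.
move=> /finite_seqP[r ->]; exists (\max_(i <- r) i).+1 => n /= nr.
by rewrite ltnS; apply: leq_bigmax_seq.
Qed.

Lemma infinite_set_unbounded (S : set nat) N :
  infinite_set S -> exists2 n, N <= n & S n.
Proof.
move=> infS; apply: contrapT => noN; apply: infS.
apply: (@sub_finite_set _ _ `I_N); last exact: finite_II.
by move=> n Sn /=; rewrite ltnNge; apply/negP => Nn; apply: noN; exists n.
Qed.

Lemma infinite_image_cancel (A : set nat) (f g : nat -> nat) :
  (forall n, A n -> g (f n) = n) -> infinite_set A -> infinite_set (f @` A).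
Proof.
move=> fK infA /(finite_image g) fin; apply: infA.
by apply: sub_finite_set fin => n An; exists (f n); [exists n|rewrite fK].
Qed.

Definition body (T : set (seq nat)) : set (nat -> nat) :=
  [set a | forall k, T (mkseq a k)].

Lemma body_closed T : closed_branches (body T).
Proof. by move=> a aE k; have [b Tb <-] := aE k. Qed.

Lemma superperfect_through T s : superperfect_tree T -> T s ->
  exists2 a, body T a & mkseq a (size s) = s.
Proof.
move=> [_ Tdown Tsplit] Ts.
have /choice[c cP] : forall t, exists t', T t ->
    [/\ prefix t t', T t' & size t < size t'].
  move=> t; have [Tt|] := pselect (T t); last by exists [::].
  have [t' [tt' Tt' /infinite_setN0[n Tn]]] := Tsplit t Tt.
  exists (rcons t' n) => _; split=> //.
    exact: prefix_trans tt' (prefix_rcons _ _).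
  by rewrite size_rcons ltnS size_prefix.
pose t n := iter n c s.
have Tt n : T (t n) by elim: n => //= n /cP[].
have st n : n <= size (t n).
  by elim: n => //= n IH; have [_ _] := cP _ (Tt n); apply: leq_ltn_trans.
have [n|//|a ta] := @chain_limit t; first by have [] := cP _ (Tt n).
exists a; last exact: (ta 0).
move=> k; apply: (Tdown _ (t k)) => //; rewrite -(ta k).
exact/mkseq_prefix/st.
Qed.

Lemma body_subset T T' : superperfect_tree T -> body T `<=` body T' -> T `<=` T'.
Proof.
move=> spT TT' s Ts; have [a Ta <-] := superperfect_through spT Ts.
exact: TT'.
Qed.

Lemma superperfectT : superperfect_tree setT.
Proof.
split=> [|//|s _]; first by exists [::].
exists s; split=> //; first exact: prefix_refl.
rewrite (_ : [set _ | _] = setT); first exact: infinite_nat.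
exact/seteqP.
Qed.

(** Diagonalization: at an infinitely splitting node one can choose a successor
    that the [n]-th finitely branching set avoids; doing this for each [n] in turn
    produces a branch outside all of them. *)
Lemma superperfect_not_sigma_bounded T :
  superperfect_tree T -> ~ sigma_bounded (body T).
Proof.
move=> spT [A fbA coverA]; have [[s0 Ts0] Tdown Tsplit] := spT.
have /choice[c cP] : forall nt, exists t', T nt.2 ->
    [/\ prefix nt.2 t', T t', size nt.2 < size t' &
        forall a, A nt.1 a -> mkseq a (size t') <> t'].
  move=> [n t]; have [Tt|] := pselect (T t); last by exists [::].
  have [t' [tt' Tt' inf]] := Tsplit t Tt.
  have [N AN] := fbA n t'.
  have [m Nm /= Tm] := infinite_set_unbounded N inf.
  exists (rcons t' m) => _; split=> //=.
  - exact: prefix_trans tt' (prefix_rcons _ _).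
  - by rewrite size_rcons ltnS size_prefix.
  - by move=> a Aa /(AN _ _ Aa); rewrite ltnNge Nm.
pose t := fix t n := if n is n'.+1 then c (n', t n') else s0.
have Tt n : T (t n) by elim: n => //= n Tn; have [] := cP (n, t n) Tn.
have st n : n <= size (t n).
  elim: n => //= n IH; have [_ _ + _] := cP (n, t n) (Tt n).
  exact: leq_ltn_trans.
have [n|//|a ta] := @chain_limit t; first by have [] := cP (n, t n) (Tt n).
have Ta : body T a.
  move=> k; apply: (Tdown _ (t k)) => //; rewrite -(ta k).
  exact/mkseq_prefix/st.
have [n _ An] := coverA a Ta.
have [_ _ _ /(_ a An)] := cP (n, t n) (Tt n).
by apply; exact: (ta n.+1).
Qed.

(** A Cantor-Bendixson argument. Removing the basic open sets on which [E] is
    sigma-bounded leaves the nodes [T]; if no extension of [s] in [T] were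
    infinitely splitting, the branches of [T] through [s] would form one finitely
    branching set, and [E] would be sigma-bounded above [s] after all. *)
Lemma not_sigma_bounded_superperfect E :
  closed_branches E -> ~ sigma_bounded E ->
  exists2 T, superperfect_tree T & body T `<=` E.
Proof.
move=> clE nsE.
pose above s := [set a | E a /\ mkseq a (size s) = s].
pose T := [set s | ~ sigma_bounded (above s)].
have Tdown s t : prefix s t -> T t -> T s.
  move=> st Tt sbs; apply: Tt; apply: sigma_bounded_sub sbs => a [Ea at_].
  by split=> //; apply: through_prefix at_.
exists T; last first.
  move=> a Ta; apply: clE => k; apply: contrapT => noE.
  apply: (Ta k); apply: finitely_branching_sigma => s; exists 0 => n b [Eb].
  by rewrite size_mkseq => bk; case: noE; exists b.
split=> //.
  by exists [::] => sb; apply: nsE; apply: sigma_bounded_sub sb.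
move=> s Ts; apply: contrapT => nosplit; apply: Ts.
(* The branches above s split into those of T, which are finitely branching, and
   those that leave T, which are covered by countably many sigma-bounded sets. *)
pose A0 := [set a | above s a /\ forall k, T (mkseq a k)].
have sA0 : sigma_bounded A0.
  apply: finitely_branching_sigma => t.
  have [[Tt pst]|nT] := pselect (T t /\ prefix s t).
    have fin : finite_set [set n | T (rcons t n)].
      by apply: contrapT => inf; apply: nosplit; exists t.
    have [N finN] := finite_set_bounded fin.
    by exists N => n a [_ Ta] atn; apply: finN; rewrite /= -atn; apply: Ta.
  exists (nth 0 s (size t)).+1 => n a [[Ea as_] Ta] /through_rcons[at_ an].
  rewrite ltnS -an; suff ts : size t < size s by rewrite -as_ nth_mkseq.
  rewrite ltnNge; apply/negP => st; apply: nT; split; first by rewrite -at_.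
  by rewrite -as_ -at_; apply: mkseq_prefix.
have sA1 : sigma_bounded (\bigcup_t [set a | ~ T t /\ above t a]).
  apply: sigma_bounded_bigcup => t; have [Tt|/contrapT sbt] := pselect (T t).
    by apply: finitely_branching_sigma => r; exists 0 => n a [].
  by apply: sigma_bounded_sub sbt => a [].
pose AA b := if b then A0 else \bigcup_t [set a | ~ T t /\ above t a].
apply: (@sigma_bounded_sub _ (\bigcup_b AA b)); last first.
  by apply: sigma_bounded_bigcup => -[].
move=> a as_; have [Ta|/existsNP[k nTk]] := pselect (forall k, T (mkseq a k)).
  by exists true.
exists false => //; exists (mkseq a k) => //; split=> //.
by split; [exact: as_.1|rewrite size_mkseq].
Qed.

(** The copy of [S] coded by [x]: the quotients by two of the entries form a node
    of [S], and their parities follow [x]. Copies with distinct codes are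
    incompatible, and a superperfect tree below a copy coded by [x] is itself a
    copy coded by [x]; so the copies with one code form a down-closed part of
    Miller forcing that is isomorphic to the whole, and there are continuum many
    such parts. *)
Definition tint (x : nat -> bool) (S : set (seq nat)) : set (seq nat) :=
  [set t | (forall k, k < size t -> odd (nth 0 t k) = x k) /\ S (map half t)].

Definition color (x : nat -> bool) (s : seq nat) : seq nat :=
  mkseq (fun k => x k + (nth 0 s k).*2) (size s).

Lemma half_color x s : map half (color x s) = s.
Proof.
apply: (@eq_from_nth _ 0); rewrite size_map size_mkseq // => k ks.
by rewrite (nth_map 0) ?size_mkseq // nth_mkseq // half_bit_double.
Qed.

Lemma odd_color x s k : k < size s -> odd (nth 0 (color x s) k) = x k.
Proof. by move=> ks; rewrite nth_mkseq // oddD odd_double addbF; case: (x k). Qed.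

Lemma tint_color x (S : set (seq nat)) s : S s -> tint x S (color x s).
Proof.
move=> Ss; split; last by rewrite half_color.
by move=> k; rewrite size_mkseq => ks; apply: odd_color.
Qed.

Lemma tint_superperfect x S : superperfect_tree S -> superperfect_tree (tint x S).
Proof.
move=> [[s0 Ss0] Sdown Ssplit]; split.
- by exists (color x s0); apply: tint_color.
- move=> s t /prefixP[r ->] [odd_t]; rewrite map_cat => St; split.
    move=> k ks; rewrite -odd_t ?nth_cat ?ks // size_cat.
    exact: leq_trans ks (leq_addr _ _).
  by apply: Sdown St; apply: prefix_prefix.
- move=> s [odd_s Ss]; have [t [st St inf]] := Ssplit _ Ss.
  have := st => /prefixP[r tE].
  have csE : color x (map half s) = s.
    apply: (@eq_from_nth _ 0); rewrite size_mkseq size_map // => k ks.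
    rewrite nth_mkseq ?size_map // (nth_map 0) // -odd_s //.
    exact: odd_double_half.
  have pre : prefix s (color x t).
    have sz : size s <= size t by rewrite -(size_map half s) size_prefix.
    rewrite prefixE take_mkseq // -{2}csE /color size_map.
    apply/eqP/agreeP => i ilt; rewrite tE nth_cat size_map ilt //.
  exists (color x t); split=> //; first exact: tint_color.
  apply: sub_infinite_set (_ : infinite_set
    ((fun n => x (size t) + n.*2) @` [set n | S (rcons t n)])); last first.
    apply: (@infinite_image_cancel _ _ half) inf => n _.
    exact: half_bit_double.
  move=> _ [n /= Sn <-].
  have -> : rcons (color x t) (x (size t) + n.*2) = color x (rcons t n).
    rewrite /color size_rcons mkseqS nth_rcons ltnn eqxx; congr rcons.
    by apply/agreeP => i it; rewrite nth_rcons it.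
  exact: tint_color.
Qed.

Lemma tint_subset x x' S S' : superperfect_tree S ->
  tint x S `<=` tint x' S' <-> x = x' /\ S `<=` S'.
Proof.
move=> spS; split=> [sub|[<- SS'] t [ot St]]; last by split=> //; apply: SS'.
split.
  apply/funext => k; have [[s0 Ss0] Sdown _] := spS.
  have [a Sa _] := superperfect_through spS Ss0.
  have [+ _] := sub _ (tint_color x (Sa k.+1)).
  move=> /(_ k); rewrite size_mkseq size_mkseq => /(_ (ltnSn k)) <-.
  by rewrite odd_color // size_mkseq.
by move=> s /(tint_color x) /sub[_]; rewrite half_color.
Qed.

Lemma subset_tint x S T : superperfect_tree T -> T `<=` tint x S ->
  exists2 S', superperfect_tree S' & T = tint x S'.
Proof.
move=> [T0 Tdown Tsplit] TS.
pose S' := [set s | T (color x s)].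
have colorE t : tint x S t -> color x (map half t) = t.
  move=> [ot _]; apply: (@eq_from_nth _ 0); rewrite size_mkseq size_map // => k kt.
  rewrite nth_mkseq ?size_map // (nth_map 0) // -ot //.
  exact: odd_double_half.
have TE : T = tint x S'.
  apply/seteqP; split=> t.
    by move=> Tt; have tSt := TS t Tt; split; [exact: tSt.1|rewrite /S' /= colorE].
  move=> [ot]; rewrite /S' /= => Tc; suff <- : color x (map half t) = t by [].
  apply: (@eq_from_nth _ 0); rewrite size_mkseq size_map // => k kt.
  rewrite nth_mkseq ?size_map // (nth_map 0) // -ot //.
  exact: odd_double_half.
exists S' => //; split.
- by have [t Tt] := T0; exists (map half t); rewrite /S' /= colorE //; exact: TS.
- move=> s t st; apply: Tdown.
  have /prefixP[r ->] := st.
  rewrite prefixE /color size_mkseq take_mkseq ?size_cat ?leq_addr //.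
  by apply/eqP/agreeP => i ilt; rewrite nth_cat ilt.
- move=> s S's; have [t [st Tt inf]] := Tsplit _ S's.
  exists (map half t); split.
  + have /prefixP[r ->] := st.
    by rewrite map_cat half_color; apply: prefix_prefix.
  + by rewrite /S' /= colorE //; exact: TS.
  + apply: (@sub_infinite_set _ (half @` [set n | T (rcons t n)])).
      move=> _ [n /= Tn <-]; rewrite /S' /= -map_rcons colorE //; exact: TS.
    apply: (@infinite_image_cancel _ _ (fun n => x (size t) + n.*2)) inf.
    move=> n /= Tn; have [+ _] := TS _ Tn.
    move=> /(_ (size t)); rewrite size_rcons nth_rcons ltnn eqxx => /(_ (ltnSn _)) <-.
    exact: odd_double_half.
Qed.

(** * Miller embeddings *)

(** The relation [c n x y] stands for [d x y < 2 ^- n] in a metric [d].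
    Indexing it by natural numbers makes all the arguments with distances
    below combinatorial. *)
Definition closeness (X : Type) (c : nat -> X -> X -> Prop) :=
  [/\ (forall n x, c n x x), (forall n x y, c n x y -> c n y x),
      (forall n x y z, c n.+1 x y -> c n.+1 y z -> c n x z) &
      (forall x y, (forall n, c n x y) -> x = y)].

Section Closeness.
Context (X : Type) (c : nat -> X -> X -> Prop) (f : X -> nat -> nat).
Hypothesis cC : closeness c.

Let c_refl n x : c n x x. Proof. by case: cC. Qed.
Let c_sym n x y : c n x y -> c n y x. Proof. by case: cC => _ + _ _; apply. Qed.
Let c_tri n x y z : c n.+1 x y -> c n.+1 y z -> c n x z.
Proof. by case: cC => _ _ + _; apply. Qed.
Let c_sep x y : (forall n, c n x y) -> x = y. Proof. by case: cC => _ _ _; apply. Qed.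

Let c_le m n x y : m <= n -> c n x y -> c m x y.
Proof.
move=> /subnK <-; elim: (n - m) => //= k IH cxy.
exact/IH/(c_tri cxy (c_refl _ _)).
Qed.

Let c_far x y : x <> y -> exists n, ~ c n x y.
Proof. by move=> xy; apply/existsNP => cxy; apply/xy/c_sep. Qed.

Definition cclosed (C : set X) :=
  forall x, (forall n, exists2 y, C y & c n x y) -> C x.

Definition continuity_set (C : set X) :=
  cclosed C /\ forall x m, C x -> exists n, forall y, C y -> c n x y ->
    mkseq (f y) m = mkseq (f x) m.

Definition small (A : set X) :=
  exists2 C : nat -> set X, (forall n, continuity_set (C n)) & A `<=` \bigcup_n C n.

Lemma continuity_set0 : continuity_set set0.
Proof. by split=> // x /(_ 0)[]. Qed.

Lemma small_sub A B : A `<=` B -> small B -> small A.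
Proof. by move=> AB [C fbC BC]; exists C => //; apply: subset_trans BC. Qed.

Lemma continuity_set_small C : continuity_set C -> small C.
Proof. by move=> cC'; exists (fun=> C) => // a Aa; exists 0. Qed.

Lemma small_bigcup (I : countType) (A : I -> set X) :
  (forall i, small (A i)) -> small (\bigcup_i A i).
Proof.
move=> sA; have {sA} /choice[B sB] : forall i, exists B : nat -> set X,
    (forall n, continuity_set (B n)) /\ A i `<=` \bigcup_n B n.
  by move=> i; have [B] := sA i; exists B.
exists (fun n => if unpickle n is Some (i, m) then B i m else set0).
  move=> n; case: unpickle => [[i m]|]; first exact: (sB i).1.
  exact: continuity_set0.
move=> a [i _ /(sB i).2[m _ Ba]]; exists (pickle (i, m)) => //.
by rewrite pickleK.
Qed.

(** If no such point exists then [f] is continuous not only at the points of [A]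
    but on its closure: the values at a point of the closure are read off from
    those at nearby points of [A]. *)
Lemma not_small_discontinuity A : ~ small A ->
  exists x m, forall n, exists2 z, A z &
    c n x z /\ mkseq (f z) m <> mkseq (f x) m.
Proof.
move=> nsA; apply: contrapT => noxm; apply: nsA.
have {noxm} cont x m : exists n, forall z, A z -> c n x z ->
    mkseq (f z) m = mkseq (f x) m.
  apply: contrapT => no; apply: noxm; exists x, m => n.
  apply: contrapT => noz; apply: no; exists n => z Az cxz.
  by apply: contrapT => fzx; apply: noz; exists z.
pose C := [set x | forall n, exists2 z, A z & c n x z].
apply: (@small_sub _ C); first by move=> x Ax n; exists x.
apply: continuity_set_small; split.
  move=> x Cx n; have [y Cy xy] := Cx n.+1; have [z Az yz] := Cy n.+1.
  by exists z => //; apply: c_tri xy yz.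
move=> x m _; have [n nP] := cont x m; exists n.+1 => y Cy xy.
have [n' n'P] := cont y m; have [z Az yz] := Cy (maxn n.+1 n').
rewrite -(nP z) ?(n'P z) //; first by apply: c_le yz; apply: leq_maxr.
by apply: c_tri xy _; apply: c_le yz; apply: leq_maxl.
Qed.

(** The last clause says that the cones above [rcons s n] converge, as [n] grows,
    to a point at which [f] is discontinuous along them. So a sequence in the
    range that escapes every compact set accumulates in [X], but never in the
    finer topology of the graph of [f]: with respect to the latter [h] is a
    closed embedding, while the closure of its range in [X] is compact. A closed
    set of continuity meets the range in a set on which both topologies agree,
    hence in a compact set. *)
Definition miller_embedding (h : (nat -> nat) -> X) :=
  [/\ injective h,
      (forall a n, exists k, forall b, mkseq b k = mkseq a k -> c n (h a) (h b)),
      (forall a m, exists k, forall b, mkseq b k = mkseq a k ->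
         mkseq (f (h b)) m = mkseq (f (h a)) m) &
      (forall s, exists x m, forall n b, mkseq b (size (rcons s n)) = rcons s n ->
         c n x (h b) /\ mkseq (f (h b)) m <> mkseq (f x) m)].

Section Embedding.
Context (h : (nat -> nat) -> X).
Hypothesis hP : miller_embedding h.

Let h_inj : injective h. Proof. by case: hP. Qed.
Let h_cont a n : exists k, forall b, mkseq b k = mkseq a k -> c n (h a) (h b).
Proof. by case: hP. Qed.
Let fh_cont a m : exists k, forall b, mkseq b k = mkseq a k ->
  mkseq (f (h b)) m = mkseq (f (h a)) m.
Proof. by case: hP. Qed.
Let h_lim s : exists x m, forall n b, mkseq b (size (rcons s n)) = rcons s n ->
  c n x (h b) /\ mkseq (f (h b)) m <> mkseq (f x) m.
Proof. by case: hP. Qed.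

(** Were infinitely many successors of [s] to meet the preimage, their limit
    point would lie in [C] and contradict the continuity of [f] on [C]. *)
Lemma preimage_finitely_branching C :
  continuity_set C -> finitely_branching (h @^-1` C).
Proof.
move=> [clC contC] s; have [x [m xm]] := h_lim s.
apply: contrapT => unb.
have {}unb N : exists n b, [/\ N <= n, C (h b) &
    mkseq b (size (rcons s n)) = rcons s n].
  apply: contrapT => no; apply: unb; exists N => n b Cb bn.
  by rewrite ltnNge; apply/negP => Nn; apply: no; exists n, b.
have Cx : C x.
  apply: clC => N; have [n [b [Nn Cb bn]]] := unb N.
  by exists (h b) => //; apply: c_le Nn _; have [] := xm _ _ bn.
have [N NP] := contC x m Cx; have [n [b [Nn Cb bn]]] := unb N.
have [xb] := xm _ _ bn; apply; apply: NP => //; exact: c_le xb.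
Qed.

Lemma cluster_image a (u : nat -> nat -> nat) x :
  (forall k N, exists2 n, N <= n & mkseq (u n) k = mkseq a k) ->
  (forall n, c n x (h (u n))) -> x = h a.
Proof.
move=> ua xu; apply: c_sep => n; have [k kP] := h_cont a n.+1.
have [N nN /kP hN] := ua k n.+1.
by apply: (@c_tri _ _ (h (u N))); [apply: c_le (xu N)|exact: c_sym].
Qed.

(** The closure of [A] is compact, so its image is closed, and [f] is continuous
    on it because [h] is a homeomorphism there. *)
Lemma image_small_of_finitely_branching A :
  finitely_branching A -> small (h @` A).
Proof.
move=> fbA; pose clA := [set a | forall k, exists2 b, A b & mkseq b k = mkseq a k].
have fbclA : finitely_branching clA.
  move=> s; have [N NP] := fbA s; exists N => n a /(_ (size (rcons s n)))[b Ab ba].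
  by rewrite -ba => /(NP _ _ Ab).
have clclA : closed_branches clA.
  by move=> a aA k; have [b bA <-] := aA k; apply: bA.
apply: (@small_sub _ (h @` clA)).
  by move=> _ [a Aa <-]; exists a => // k; exists a.
apply: continuity_set_small; split.
  move=> x xA; have {xA} /choice[u uP] : forall n, exists a, clA a /\ c n x (h a).
    by move=> n; have [_ [a Aa <-] xa] := xA n; exists a.
  have [a ua] := konig fbclA (fun n => (uP n).1).
  exists a; last by rewrite (cluster_image ua (fun n => (uP n).2)).
  by apply: clclA => k; have [n _ un] := ua k 0; exists (u n) => //; case: (uP n).
move=> _ m [a Aa <-]; apply: contrapT => no.
have /choice[u uP] : forall n, exists b, clA b /\
    (c n (h a) (h b) /\ mkseq (f (h b)) m <> mkseq (f (h a)) m).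
  move=> n; apply: contrapT => nob; apply: no; exists n => _ [b Ab <-] ab.
  by apply: contrapT => fab; apply: nob; exists b.
have [b ub] := konig fbclA (fun n => (uP n).1).
have hab := cluster_image ub (fun n => (uP n).2.1).
have [k kP] := fh_cont b m; have [n _ un] := ub k 0.
by case: (uP n) => _ [_]; rewrite hab; apply; apply: kP.
Qed.

Lemma image_small A : sigma_bounded A -> small (h @` A).
Proof.
move=> [B fbB AB]; apply: (@small_sub _ (\bigcup_n (h @` B n))).
  by move=> _ [a /AB[n _ Ba] <-]; exists n => //; exists a.
by apply: small_bigcup => n; apply: image_small_of_finitely_branching.
Qed.

Lemma small_preimage S : small S -> sigma_bounded (h @^-1` S).
Proof.
move=> [C cC' SC]; exists (fun n => h @^-1` C n).
  by move=> n; apply: preimage_finitely_branching.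
by move=> a /SC[n _ Ca]; exists n.
Qed.

Lemma superperfect_image_not_small T :
  superperfect_tree T -> ~ small (h @` body T).
Proof.
move=> spT sT; apply: (superperfect_not_sigma_bounded spT).
by apply: sigma_bounded_sub (small_preimage sT) => a Ta; exists a.
Qed.

(** Compare the limit [x] with the limit point [y] of the cones above [s]. If
    they are equal, the values of [f] keep the sequence out of these cones; if
    not, points close to [x] are far from [y]. Either way only finitely many
    terms of the sequence, or finitely many cones, are left. *)
Lemma graph_convergent_finitely_branching (u : nat -> nat -> nat) x :
  (forall n, c n x (h (u n)) /\ mkseq (f (h (u n))) n = mkseq (f x) n) ->
  finitely_branching (range u).
Proof.
move=> ux s; have [y [m ym]] := h_lim s.
suff [N NP] : exists N, forall n k, N <= n -> N <= k ->
    mkseq (u k) (size (rcons s n)) <> rcons s n.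
  (* Terms with index at least N avoid the cones with index at least N; each of
     the remaining terms lies in a single cone. *)
  exists (maxn N (\max_(k < N) (u k (size s)).+1)) => n _ [k _ <-] ukn.
  have /through_rcons[_ un] := ukn; rewrite leq_max.
  have [kN|Nk] := ltnP k N; last first.
    have [//|Nn] := ltnP n N.
    by case: (NP n k Nn Nk).
  apply/orP; right; rewrite -un.
  exact: (@leq_bigmax _ (fun k : 'I_N => (u k (size s)).+1) (Ordinal kN)).
have [yx|/c_far[p yx]] := pselect (y = x).
  exists m => n k _ mk ukn; have [_] := ym _ _ ukn; apply.
  by rewrite yx; apply: agree_le mk (ux k).2.
exists p.+1 => n k pn pk ukn; apply: yx.
apply: (@c_tri _ _ (h (u k))); first exact: c_le pn (ym _ _ ukn).1.
exact/c_sym/(c_le pk)/(ux k).1.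
Qed.

(** Images of closed sets are closed in the topology of the graph of [f]: if the
    images of a sequence converge there, the sequence has a cluster point. *)
Lemma image_graph_closed A x : closed_branches A ->
  (forall n, exists2 a, A a & c n x (h a) /\ mkseq (f (h a)) n = mkseq (f x) n) ->
  (h @` A) x.
Proof.
move=> clA xA; have {xA} /choice[u uP] : forall n, exists a, A a /\
    (c n x (h a) /\ mkseq (f (h a)) n = mkseq (f x) n).
  by move=> n; have [a] := xA n; exists a.
have fbu := graph_convergent_finitely_branching (fun n => (uP n).2).
have [a ua] := konig fbu (fun n => imageT u n).
exists a; last by rewrite -(cluster_image ua (fun n => (uP n).2.1)).
by apply: clA => k; have [n _ un] := ua k 0; exists (u n) => //; case: (uP n).
Qed.

Lemma image_body_subset T T' : superperfect_tree T ->
  h @` body T `<=` h @` body T' -> T `<=` T'.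
Proof.
move=> spT sub; apply: body_subset => // a Ta.
by have [b T'b /h_inj <-] := sub (h a) (imageP h Ta).
Qed.

End Embedding.

(** The pullback of the range of [h'] is closed, because that range is closed for
    the graph topology, and not sigma-bounded, because that range is not small. *)
Lemma embedding_refine h h' : miller_embedding h -> miller_embedding h' ->
  range h' `<=` range h ->
  exists2 T, superperfect_tree T & h @` body T `<=` range h'.
Proof.
move=> hP h'P sub; pose E := h @^-1` range h'.
have clE : closed_branches E.
  move=> a aE; apply: (image_graph_closed h'P) => //= n.
  have [_ /(_ a n)[k kP] /(_ a n)[k' k'P] _] := hP.
  have [b [b' _ hb] ba] := aE (maxn k k'); exists b' => //; rewrite hb.
  split; first by apply: kP; apply: agree_le ba; apply: leq_maxl.
  by apply: k'P; apply: agree_le ba; apply: leq_maxr.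
have nsE : ~ sigma_bounded E.
  move=> sE; apply: (superperfect_image_not_small h'P superperfectT).
  apply: small_sub (image_small hP sE) => _ [b _ <-].
  by have [a _ ab] := sub (h' b) (imageT h' b); exists a => //; exists b.
have [T spT TE] := not_sigma_bounded_superperfect clE nsE.
by exists T => // _ [a /TE ? <-].
Qed.

(** Continuity into the graph of [f]. *)
Definition continuous_on (F : set (nat -> nat)) (g : (nat -> nat) -> X) :=
  (forall z n, F z -> exists k, forall z', F z' -> mkseq z' k = mkseq z k ->
     c n (g z) (g z')) /\
  (forall z m, F z -> exists k, forall z', F z' -> mkseq z' k = mkseq z k ->
     mkseq (f (g z')) m = mkseq (f (g z)) m).

Lemma continuous_on_sub F F' g : F' `<=` F -> continuous_on F g -> continuous_on F' g.
Proof.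
move=> sub [cg fg]; split=> z n /sub Fz.
  by have [k kP] := cg z n Fz; exists k => z' /sub; apply: kP.
by have [k kP] := fg z n Fz; exists k => z' /sub; apply: kP.
Qed.

(** The fusion: if the image of every nonempty cone of [F] is not small, each
    such cone yields a point of discontinuity and a sequence converging to it,
    around whose terms the next cones are chosen. *)
Section Scheme.
Context (F : set (nat -> nat)) (g : (nat -> nat) -> X).
Hypothesis clF : closed_branches F.
Hypothesis gP : continuous_on F g.

Let cone t := [set z | F z /\ mkseq z (size t) = t].
Hypothesis large : forall t, cone t !=set0 -> ~ small (g @` cone t).

(** The cones are separated by putting their images in disjoint annuli around
    the limit point [x]. *)
Let annulus t : cone t !=set0 -> exists x m, forall p, exists u p',
  [/\ prefix t u, size t < size u, cone u !=set0, p < p' &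
      forall z, cone u z -> [/\ c p x (g z), ~ c p' x (g z) &
        mkseq (f (g z)) m <> mkseq (f x) m]].
Proof.
move=> /large /not_small_discontinuity[x [m xm]]; exists x, m => p.
have [_ [z [Fz zt] <-] [xz fxz]] := xm p.+1.
have /c_far[r rxz] : x <> g z by move=> xz'; apply: fxz; rewrite -xz'.
have [cg fg] := gP; have [k kP] := cg z (maxn p r).+1 Fz.
have [k' k'P] := fg z m Fz.
pose K := maxn (maxn k k') (size t).+1.
exists (mkseq z K), (maxn p r).+1; split.
- by rewrite -zt; apply: mkseq_prefix; rewrite /K; lia.
- by rewrite size_mkseq /K; lia.
- by exists z; split=> //; rewrite size_mkseq.
- by lia.
move=> z' []; rewrite size_mkseq => Fz' z'z.
have {kP} czz' : c (maxn p r).+1 (g z) (g z').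
  by apply: kP => //; apply: agree_le z'z; rewrite /K; lia.
split.
- by apply: c_tri xz _; apply: c_le czz'; lia.
- move=> xz'; apply: rxz; apply: (@c_le _ (maxn p r)); first exact: leq_maxr.
  exact: c_tri xz' (c_sym czz').
- by rewrite (k'P z') //; apply: agree_le z'z; rewrite /K; lia.
Qed.

Let children t : cone t !=set0 -> exists x m (u : nat -> seq nat),
  [/\ (forall n, [/\ prefix t (u n), size t < size (u n) & cone (u n) !=set0]),
      (forall n z, cone (u n) z -> c n x (g z) /\ mkseq (f (g z)) m <> mkseq (f x) m) &
      (forall n n' z z', n <> n' -> cone (u n) z -> cone (u n') z' -> g z <> g z')].
Proof.
move=> /annulus[x [m]] /choice[u0 /choice[next uP]].
(* The outer radius of each annulus is the inner radius of the preceding one. *)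
pose r n := iter n next 0.
have rS n : r n < r n.+1 by have [] := uP (r n).
have r_le n n' : n <= n' -> r n <= r n'.
  by elim: n' => [|n' IH]; [rewrite leqn0 => /eqP->|rewrite leq_eqVlt =>
    /orP[/eqP->//|/IH le]; exact: leq_trans le (ltnW (rS _))].
have r_ge n : n <= r n by elim: n => // n IH; apply: leq_ltn_trans (rS n).
exists x, m, (u0 \o r); split.
- by move=> n; have [] := uP (r n).
- move=> n z zu; have [_ _ _ _ /(_ z zu)[xz _ fz]] := uP (r n); split=> //.
  exact: c_le xz.
have sep n n' z z' : n < n' -> cone (u0 (r n)) z -> cone (u0 (r n')) z' -> g z <> g z'.
  move=> nn' zu zu' gzz'.
  have [_ _ _ _ /(_ z zu)[_ + _]] := uP (r n); apply.
  rewrite gzz'; have [_ _ _ _ /(_ z' zu')[xz' _ _]] := uP (r n').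
  by apply: c_le xz'; apply: (r_le n.+1).
move=> n n' z z' /eqP; rewrite neq_ltn => /orP[nn'|nn'] zu zu'; first exact: sep zu zu'.
by apply/nesym; apply: sep zu' zu.
Qed.

Lemma scheme_embedding : F !=set0 ->
  exists2 h, miller_embedding h & range h `<=` g @` F.
Proof.
move=> [z0 Fz0].
have /choice[U UP] : forall t, exists u : nat -> seq nat, cone t !=set0 ->
  exists x m, [/\ (forall n, [/\ prefix t (u n), size t < size (u n) & cone (u n) !=set0]),
      (forall n z, cone (u n) z -> c n x (g z) /\ mkseq (f (g z)) m <> mkseq (f x) m) &
      (forall n n' z z', n <> n' -> cone (u n) z -> cone (u n') z' -> g z <> g z')].
  move=> t; have [/children[x [m [u uP]]]|nt] := pselect (cone t !=set0).
    by exists u => _; exists x, m.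
  by exists (fun=> [::]).
pose t s := foldl U [::] s.
have tS s n : t (rcons s n) = U (t s) n by rewrite /t foldl_rcons.
have t_ne s : cone (t s) !=set0.
  elim/last_ind: s => [|s n /UP[x [m [+ _ _]]]]; first by exists z0.
  by rewrite tS => /(_ n)[].
have t_pre s n : prefix (t s) (t (rcons s n)).
  by have [x [m [/(_ n)[+ _ _] _ _]]] := UP _ (t_ne s); rewrite tS.
have t_size s : size s <= size (t s).
  elim/last_ind: s => // s n IH; have [x [m [/(_ n)[_ + _] _ _]]] := UP _ (t_ne s).
  by rewrite tS size_rcons; apply: leq_ltn_trans.
have /choice[z zP] : forall a : nat -> nat, exists z : nat -> nat, forall n,
    mkseq z (size (t (mkseq a n))) = t (mkseq a n).
  move=> a; apply: chain_limit => n; first by rewrite mkseqS.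
  by have := t_size (mkseq a n); rewrite size_mkseq.
have agree_z a b k : mkseq b k = mkseq a k -> mkseq (z b) k = mkseq (z a) k.
  move=> ba; apply: (@agree_le _ (size (t (mkseq a k)))).
    by have := t_size (mkseq a k); rewrite size_mkseq.
  by rewrite zP -ba zP.
have Fz a : F (z a).
  apply: clF => k; have [b [Fb bt]] := t_ne (mkseq a k).
  exists b => //; apply: (@agree_le _ (size (t (mkseq a k)))).
    by have := t_size (mkseq a k); rewrite size_mkseq.
  by rewrite bt zP.
have cone_z s b : mkseq b (size s) = s -> cone (t s) (z b).
  by move=> bs; split=> //; rewrite -bs zP.
exists (g \o z); last by move=> _ [a _ <-]; exists (z a).
have [cg fg] := gP; split.
- move=> a b /= gab; apply: contrapT => ab.
  have ex : exists i, a i != b i.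
    apply: contrapT => no; apply: ab; apply/funext => i.
    by apply/eqP; apply: contrapT => /negP abi; apply: no; exists i.
  have [i abi mini] := ex_minnP ex.
  have agr : mkseq b i = mkseq a i.
    apply/agreeP => j ji; apply/esym/eqP; apply: contraTT ji => abj.
    by rewrite -leqNgt mini.
  have [x [m [_ _ disj]]] := UP _ (t_ne (mkseq a i)).
  apply: (disj (a i) (b i) (z a) (z b)) => //; first exact/eqP.
    rewrite -tS -mkseqS; apply: cone_z; by rewrite size_mkseq.
  rewrite -tS -agr -mkseqS; apply: cone_z; by rewrite size_mkseq.
- move=> a n; have [k kP] := cg (z a) n (Fz a).
  by exists k => b /agree_z; apply: kP.
- move=> a m; have [k kP] := fg (z a) m (Fz a).
  by exists k => b /agree_z; apply: kP.
- move=> s; have [x [m [_ lim _]]] := UP _ (t_ne s).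
  by exists x, m => n b /cone_z bn; apply: lim; rewrite -tS.
Qed.

End Scheme.

(** The analytic sets for the topology of the graph of [f], with a closed set of
    sequences as the domain of the parametrization. *)
Definition parametrized (B : set X) := exists F g,
  [/\ closed_branches F, continuous_on F g & g @` F = B].

(** Deleting the countably many cones of [F] with a small image costs only a
    small set, and leaves a closed set all of whose nonempty cones have an image
    that is not small. *)
Lemma parametrized_embedding B : parametrized B -> ~ small B ->
  exists2 h, miller_embedding h & range h `<=` B.
Proof.
move=> [F [g [clF gP <-]]] large.
pose cone E t := [set z : nat -> nat | E z /\ mkseq z (size t) = t].
pose F' := [set z | F z /\ forall n, ~ small (g @` cone F (mkseq z n))].
have thin t : small (g @` cone F' t) -> small (g @` cone F t).
  move=> small'.
  (* None indexes what survives, Some s the part removed with the cone of s. *)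
  pose A (o : option (seq nat)) := if o isn't Some s then g @` cone F' t
    else [set x | small (g @` cone F s) /\ (g @` cone F s) x].
  apply: (@small_sub _ (\bigcup_o A o)); last first.
    apply: small_bigcup => -[s|//]; have [ss|ns] := pselect (small (g @` cone F s)).
      by apply: small_sub ss => x [].
    by apply: small_sub (continuity_set_small continuity_set0) => x [].
  move=> _ [z [Fz zt] <-].
  have [F'z|] := pselect (F' z); first by exists None => //; exists z.
  move=> /not_andP[//|/existsNP[n /contrapT sn]].
  exists (Some (mkseq z n)) => //; split=> //; exists z => //; split=> //.
  by rewrite size_mkseq.
have [||||h hP hF'] := @scheme_embedding F' g.
- move=> z zF'; have Fz : F z.
    by apply: clF => k; have [b [Fb _] ba] := zF' k; exists b.
  by split=> // n; have [b [_ +] <-] := zF' n; apply.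
- by apply: continuous_on_sub gP => z [].
- move=> t [z [F'z zt]] /thin; have [_ /(_ (size t))] := F'z.
  by rewrite zt.
- apply: contrapT => F'0; apply: large.
  apply: (@small_sub _ (g @` cone F [::])); first by move=> _ [z Fz <-]; exists z.
  apply: thin; apply: small_sub (continuity_set_small continuity_set0).
  by move=> _ [z [F'z _] <-]; case: F'0; exists z.
exists h => //; apply: subset_trans hF' _ => _ [z [Fz _] <-]; by exists z.
Qed.

End Closeness.

(** * Borel sets as parametrized sets *)

(** A sequence is read as a countable family of sequences, its columns. *)
Definition column (n : nat) (z : nat -> nat) : nat -> nat := fun i => z (pickle (n, i)).

Definition assemble (w : nat -> nat -> nat) : nat -> nat :=
  fun k => if unpickle k is Some (n, i) then w n i else 0.

Lemma column_assemble w n : column n (assemble w) = w n.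
Proof. by apply/funext => i; rewrite /column /assemble pickleK. Qed.

Lemma column_agree n k : exists K, forall z z',
  mkseq z' K = mkseq z K -> mkseq (column n z') k = mkseq (column n z) k.
Proof.
exists (\max_(i < k) pickle (n, i : nat)).+1 => z z' /agreeP zz'.
apply/agreeP => i ik; apply: zz'; rewrite ltnS.
exact: (@leq_bigmax _ (fun i : 'I_k => pickle (n, i : nat)) (Ordinal ik)).
Qed.

Section Parametrization.
Context (X : Type) (c : nat -> X -> X -> Prop) (f : X -> nat -> nat).
Hypothesis cC : closeness c.

Let c_refl n x : c n x x. Proof. by case: cC. Qed.
Let c_sym n x y : c n x y -> c n y x. Proof. by case: cC => _ + _ _; apply. Qed.
Let c_tri n x y z : c n.+1 x y -> c n.+1 y z -> c n x z.
Proof. by case: cC => _ _ + _; apply. Qed.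
Let c_sep x y : (forall n, c n x y) -> x = y. Proof. by case: cC => _ _ _; apply. Qed.
Let c_S n x y : c n.+1 x y -> c n x y.
Proof. by move=> xy; apply: c_tri xy _. Qed.

Local Notation parametrized := (parametrized c f).

Lemma parametrized_bigcup (B : nat -> set X) :
  (forall n, parametrized (B n)) -> parametrized (\bigcup_n B n).
Proof.
move=> /choice[F /choice[g FgP]].
pose tail (z : nat -> nat) i := z i.+1.
have tail_agree z z' k : mkseq z' k.+1 = mkseq z k.+1 ->
    z' 0 = z 0 /\ mkseq (tail z') k = mkseq (tail z) k.
  by move=> /agreeP zz'; split; [exact: zz'|apply/agreeP => i ik; exact: zz'].
exists [set z | F (z 0) (tail z)], (fun z => g (z 0) (tail z)); split.
- move=> z zF; have [clF _ _] := FgP (z 0); apply: clF => k.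
  have [z' Fz' /tail_agree[z0 zt]] := zF k.+1.
  by exists (tail z') => //; rewrite -z0.
- split=> z n /= Fz; have [_ [cg fg] _] := FgP (z 0).
    have [k kP] := cg _ n Fz; exists k.+1 => z' /= Fz' /tail_agree[z0 zt].
    by rewrite z0 in Fz' *; apply: kP.
  have [k kP] := fg _ n Fz; exists k.+1 => z' /= Fz' /tail_agree[z0 zt].
  by rewrite z0 in Fz' *; apply: kP.
- apply/seteqP; split=> [_ [z Fz <-]|x [n _]].
    by exists (z 0) => //; have [_ _ <-] := FgP (z 0); exists (tail z).
  have [_ _ <-] := FgP n => -[z Fz <-].
  by exists (fun i => if i is i'.+1 then z i' else n).
Qed.

Lemma parametrized_bigcap (B : nat -> set X) :
  (forall n, parametrized (B n)) -> parametrized (\bigcap_n B n).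
Proof.
move=> /choice[F /choice[g FgP]].
pose E := [set z | forall n, F n (column n z) /\ g n (column n z) = g 0 (column 0 z)].
have clF n : closed_branches (F n) by have [] := FgP n.
have [cg fg] : (forall n, continuous_on c f (F n) (g n)) /\ True.
  by split=> // n; have [] := FgP n.
exists E, (fun z => g 0 (column 0 z)); split.
- move=> z zE.
  have Fz n : F n (column n z).
    apply: clF => k; have [K KP] := column_agree n k.
    have [z' Ez' /KP zz'] := zE K.
    by exists (column n z') => //; case: (Ez' n).
  move=> n; split=> //; apply: c_sep => m.
  have [k kP] := (cg n).1 _ m.+1 (Fz n); have [k0 k0P] := (cg 0).1 _ m.+1 (Fz 0).
  have [K KP] := column_agree n k; have [K0 K0P] := column_agree 0 k0.
  have [z' Ez' zz'] := zE (maxn K K0).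
  apply: (@c_tri _ _ (g n (column n z'))).
    apply: kP; first by case: (Ez' n).
    by apply: KP; apply: agree_le zz'; apply: leq_maxl.
  rewrite (Ez' n).2; apply/c_sym/k0P; first by case: (Ez' 0).
  by apply: K0P; apply: agree_le zz'; apply: leq_maxr.
- split=> z m /(_ 0)[/= Fz _].
    have [k kP] := (cg 0).1 _ m Fz; have [K KP] := column_agree 0 k.
    by exists K => z' /(_ 0)[Fz' _] /KP; apply: kP.
  have [k kP] := (cg 0).2 _ m Fz; have [K KP] := column_agree 0 k.
  by exists K => z' /(_ 0)[Fz' _] /KP; apply: kP.
- apply/seteqP; split=> [_ [z Ez <-] n _|x Bx].
    by have [Fz <-] := Ez n; have [_ _ <-] := FgP n; exists (column n z).
  have /choice[w wP] : forall n, exists w, F n w /\ g n w = x.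
    move=> n; have := Bx n Logic.I; have [_ _ <-] := FgP n.
    by case=> w; exists w.
  exists (assemble w); last by rewrite column_assemble; case: (wP 0).
  move=> n; rewrite !column_assemble; split; first by case: (wP n).
  by rewrite (wP n).2 (wP 0).2.
Qed.

Lemma parametrized_closedI C B :
  cclosed c C -> parametrized B -> parametrized (B `&` C).
Proof.
move=> clC [F [g [clF gP <-]]]; have [cg fg] := gP.
exists [set z | F z /\ C (g z)], g; split.
- move=> z zF; have Fz : F z.
    by apply: clF => k; have [z' [Fz' _] zz'] := zF k; exists z'.
  split=> //; apply: clC => n; have [k kP] := cg z n Fz.
  by have [z' [Fz' Cz'] zz'] := zF k; exists (g z') => //; apply: kP.
- by apply: continuous_on_sub gP => z [].
- apply/seteqP; split=> [_ [z [Fz Cz] <-]|x [[z Fz <-] Cz]].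
    by split=> //; exists z.
  by exists z.
Qed.

Context (q : nat -> X).
Hypothesis q_dense : forall x n, exists i, c n x (q i).
Hypothesis c_complete : forall u : nat -> X, (forall k, c k (u k) (u k.+1)) ->
  exists x, forall k, c k x (u k.+2).
Hypothesis f_Fsigma : forall s, exists C : nat -> set X,
  (forall n, cclosed c (C n)) /\
  forall x, mkseq (f x) (size s) = s <-> exists n, C n x.

(** This is where the Baire class of [f] enters. The first column of [z] is a
    fast Cauchy sequence in the dense set, with limit [x]; the second is
    the value [f x]; the third names, for each initial segment of that value, a
    closed piece of its preimage that contains [x]. The last condition is closed,
    and it forces the second column to be [f x], so [f x] depends continuously
    on [z]. *)
Lemma parametrizedT : parametrized setT.
Proof.
have /choice[C CP] := f_Fsigma.
pose A := [set z : nat -> nat | forall k, c k (q (z k)) (q (z k.+1))].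
have /choice[p pP] : forall z : nat -> nat, exists x, A z ->
    forall k, c k x (q (z k.+2)).
  move=> z; have [Az|] := pselect (A z); last by exists (q 0).
  by have [x xz] := c_complete Az; exists x.
have p_cont z z' n : A z -> A z' -> mkseq z' n.+4 = mkseq z n.+4 -> c n (p z) (p z').
  move=> Az Az' /agreeP zz'; have := pP z' Az' n.+1.
  rewrite zz' // => z'q; exact: c_tri (pP z Az n.+1) (c_sym z'q).
pose F := [set z | A (column 0 z) /\ forall n,
  C (mkseq (column 1 z) n) (column 2 z n) (p (column 0 z))].
have fE z : F z -> f (p (column 0 z)) = column 1 z.
  move=> [_ CF]; apply/funext => i.
  have /(CP _).2 : exists j, C (mkseq (column 1 z) i.+1) j (p (column 0 z)).
    by exists (column 2 z i.+1).
  by rewrite size_mkseq => /agreeP; apply.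
have p0_cont z n : exists K, forall z', A (column 0 z) -> A (column 0 z') ->
    mkseq z' K = mkseq z K -> c n (p (column 0 z)) (p (column 0 z')).
  have [K KP] := column_agree 0 n.+4.
  by exists K => z' Az Az' /KP; apply: p_cont.
exists F, (fun z => p (column 0 z)); split.
- move=> z zF.
  have Az : A (column 0 z).
    move=> k; have [K KP] := column_agree 0 k.+2.
    have [z' [Az' _] /KP /agreeP zz'] := zF K.
    by rewrite -!zz' //; exact: Az'.
  split=> // n; apply: (CP _).1 => m.
  have [K KP] := p0_cont z m; have [K1 K1P] := column_agree 1 n.
  have [K2 K2P] := column_agree 2 n.+1.
  have [z' [Az' Cz'] zz'] := zF (maxn K (maxn K1 K2)).
  have z1 : mkseq (column 1 z') n = mkseq (column 1 z) n.
    by apply: K1P; apply: agree_le zz'; lia.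
  have z2 : column 2 z' n = column 2 z n.
    suff /agreeP : mkseq (column 2 z') n.+1 = mkseq (column 2 z) n.+1 by apply.
    by apply: K2P; apply: agree_le zz'; lia.
  exists (p (column 0 z')); first by rewrite -z1 -z2.
  by apply: KP => //; apply: agree_le zz'; lia.
- split=> z n Fz.
    by have [K KP] := p0_cont z n; exists K => z' [Az' _]; apply: KP => //; case: Fz.
  have [K KP] := column_agree 1 n.
  by exists K => z' Fz' /KP; rewrite !fE.
- apply/seteqP; split=> // x _.
  have /choice[z0 z0P] : forall k, exists i, c k.+1 x (q i) by move=> k; exact: q_dense.
  have Az0 : A z0 by move=> k; apply: (@c_tri _ _ x); [exact: c_sym|exact/c_S].
  have pz0 : p z0 = x.
    apply: c_sep => k; apply: (@c_tri _ _ (q (z0 k.+3))); first exact: pP.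
    by apply/c_sym/c_S/c_S/c_S.
  have /choice[z2 z2P] : forall n, exists j, C (mkseq (f x) n) j x.
    by move=> n; apply/(CP _).2; rewrite size_mkseq.
  pose w n := if n is n'.+1 then if n' is 0 then f x else z2 else z0.
  exists (assemble w); last by rewrite column_assemble.
  by split; rewrite !column_assemble // => n; rewrite pz0.
Qed.

Lemma parametrized_closed C : cclosed c C -> parametrized C.
Proof.
move=> clC; rewrite -(setTI C); apply: parametrized_closedI => //.
exact: parametrizedT.
Qed.

Lemma parametrized_open (U : set X) :
  (forall x, U x -> exists n, forall y, c n x y -> U y) -> parametrized U.
Proof.
move=> oU.
pose C n := [set x | forall m, exists2 x', c m x x' & forall y, c n x' y -> U y].
have -> : U = \bigcup_n C n.
  apply/seteqP; split=> [x Ux|x [n _ Cx]].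
    by have [n nP] := oU x Ux; exists n => // m; exists x.
  by have [x' xx' x'U] := Cx n; apply/x'U/c_sym.
apply: parametrized_bigcup => n; apply: parametrized_closed => x xC m.
have [y Cy xy] := xC m.+1; have [x' yx' x'U] := Cy m.+1.
by exists x' => //; apply: c_tri xy yx'.
Qed.

(** The class of sets that are parametrized together with their complements is a
    sigma-algebra. *)
Lemma parametrized_measurable (G : set (set X)) :
  (forall U, G U -> forall x, U x -> exists n, forall y, c n x y -> U y) ->
  forall B, <<s G >> B -> parametrized B.
Proof.
move=> Gopen B GB; suff : parametrized B /\ parametrized (~` B) by case.
apply: (GB [set B | parametrized B /\ parametrized (~` B)]); split.
- split.
  + split; last by rewrite setC0; exact: parametrizedT.
    by apply: parametrized_open.
  + by move=> A [pA pcA]; rewrite /= setTD setCK.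
  + move=> A pA; split; first by apply: parametrized_bigcup => n; case: (pA n).
    by rewrite setC_bigcup; apply: parametrized_bigcap => n; case: (pA n).
- move=> U /Gopen oU; split; first exact: parametrized_open.
  apply: parametrized_closed => x xU Ux; have [n nU] := oU x Ux.
  by have [y + /nU] := xU n.
Qed.

End Parametrization.

(** * The topological content of the closeness relation *)

Lemma nbhs_baire (y : baire_space) (S : set baire_space) :
  nbhs y S <-> exists m, forall y' : nat -> nat, mkseq y' m = mkseq y m -> S y'.
Proof.
split=> [|[m mS]]; last first.
  apply: (@filterS _ _ _ [set y' : baire_space | mkseq y' m = mkseq y m]) => //.
  elim: m {mS} => [|m IH]; first exact: filterS filterT.
  have ym : nbhs y (proj m @^-1` [set y m] : set baire_space).
    exact/(@proj_continuous _ (fun=> nat) m y)/discrete_set1.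
  apply: filterS (filterI IH ym) => y' [/= y'm ym'].
  have {}ym' : y' m = y m := ym'.
  by rewrite !mkseqS y'm ym'.
(* The filter generated by the cylinders around y converges to y, as it does so
   in each coordinate. *)
pose Fl : set_system baire_space := filter_from setT
  (fun m => [set y' : baire_space | mkseq y' m = mkseq y m]).
have FF : Filter Fl.
  apply: filter_from_filter => [|m n _ _]; first by exists 0.
  by exists (maxn m n) => // y' y'y; split;
    apply: agree_le y'y; rewrite ?leq_maxl ?leq_maxr.
have Fy : Fl --> y.
  apply/cvg_sup => i; apply/cvg_image.
    by apply/seteqP; split=> // k _; exists (fun=> k).
  move=> V /principal_filterP Vy; exists ((fun g : nat -> nat => g i) @^-1` V).
    by exists i.+1 => // y' /agreeP /(_ i (ltnSn i)) /= ->.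
  by apply: image_preimage; apply/seteqP; split=> // k _; exists (fun=> k).
by move=> /Fy [m _ mS]; exists m => y'; apply: mS.
Qed.

(** The closeness relation induces the topology. *)
Definition compatible (X : topologicalType) (c : nat -> X -> X -> Prop) :=
  forall (x : X) (S : set X), nbhs x S <-> exists n, forall y, c n x y -> S y.

Lemma polish_closeness (R : realType) (X : topologicalType) (x0 : X) :
  polish R X -> exists (c : nat -> X -> X -> Prop) (q : nat -> X),
  [/\ closeness c, compatible c, (forall x n, exists i, c n x (q i)) &
      forall u : nat -> X, (forall k, c k (u k) (u k.+1)) ->
        exists x, forall k, c k x (u k.+2)].
Proof.
move=> [[D cD dD] [M [h [g [hK gK hcont gcont complete]]]]].
pose r n : R := (1 / 2 ^+ n)%R.
have r0 n : (0 < r n)%R by rewrite /r div1r invr_gt0 exprn_gt0.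
have rS n : (r n.+1 + r n.+1 = r n)%R.
  by rewrite [RHS]splitr /r exprSr invfM mulrA.
have r_small (e : R) : (0 < e)%R -> exists n, (r n < e)%R.
  move=> e0; have [N _ NP] := near_infty_natSinv_expn_lt (PosNum e0).
  by exists N; apply: (NP N) => /=.
pose c n x y := ball (h x) (r n) (h y).
have c_refl n x : c n x x by apply: ballxx; exact: r0.
have c_sym n x y : c n x y -> c n y x by exact: ball_sym.
have c_tri n x y z : c n.+1 x y -> c n.+1 y z -> c n x z.
  by move=> xy yz; rewrite /c -rS; apply: ball_triangle xy yz.
have c_sep x y : (forall n, c n x y) -> x = y.
  move=> xy; apply: (can_inj hK); apply: metric_hausdorff => A B.
  move=> nA /nbhs_ballP[e /= e0 eB]; exists (h y); split; last exact/eB/ballxx.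
  move/nbhs_ballP : nA => [e' /= e'0]; apply.
  by have [n /ltW/le_ball] := r_small _ e'0; apply; exact: xy.
have c_nbhs : compatible c.
  move=> x S; split=> [nS|[n nS]].
    have : nbhs (h x) (g @^-1` S) by apply: gcont; rewrite hK.
    move/nbhs_ballP => [e /= e0 eS]; have [n ne] := r_small _ e0.
    exists n => y xy; rewrite -(hK y); apply: eS.
    exact: le_ball (ltW ne) _ xy.
  apply: (@filterS _ _ _ (h @^-1` ball (h x) (r n))); first by move=> y; apply: nS.
  exact/hcont/nbhsx_ballx.
have Dne : D !=set0.
  by have [||x [_ Dx]] := dD setT; [exists x0|exact: openT|exists x].
have /countable_injP[j jinj] := cD.
have /choice[q qP] : forall n, exists x, D x /\ ((exists2 y, D y & j y = n) -> j x = n).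
  move=> n; have [[y Dy <-]|no] := pselect (exists2 y, D y & j y = n); first by exists y.
  by have [x Dx] := Dne; exists x.
have qj x : D x -> q (j x) = x.
  move=> Dx; have [Dq jq] := qP (j x); apply: jinj; rewrite ?inE //.
  by apply: jq; exists x.
exists c, q; split=> //.
- move=> x n.
  have [||y [+ Dy]] := dD (interior [set y | c n x y]).
  + by exists x; apply/c_nbhs; exists n.
  + exact: open_interior.
  + by move=> /interior_subset xy; exists (j y); rewrite qj.
- move=> u uS.
  have u_close k d : c k (u k.+1) (u (k.+1 + d)).
    elim: d k => [|d IH] k; first by rewrite addn0.
    by apply: c_tri (uS k.+1) _; rewrite -addSnnS; apply: IH.
  have u_le k l : k < l -> c k (u k.+1) (u l) by move=> /subnKC <-.
  have [|x ux] := complete ((h \o u) @ \oo).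
    apply: cauchy_exP => e e0; have [n ne] := r_small e e0.
    exists (h (u n.+1)); exists n.+1 => // l /= nl.
    exact: le_ball (ltW ne) _ (u_le n l nl).
  exists (g x) => k.
  have [N _ NP] := ux _ (nbhsx_ballx x _ (r0 k.+1)).
  pose l := maxn N k.+2.
  apply: (@c_tri _ _ (u l)).
    by rewrite /c gK; apply: (NP l); rewrite /= leq_maxl.
  by apply/c_sym/u_le; rewrite /l leq_max ltnSn orbT.
Qed.

Section Bridge.
Context (X : topologicalType) (c : nat -> X -> X -> Prop) (f : X -> baire_space).
Hypothesis c_nbhs : compatible c.

Lemma open_closeness (U : set X) :
  open U -> forall x, U x -> exists n, forall y, c n x y -> U y.
Proof. by move=> oU x Ux; apply/c_nbhs/open_nbhs_nbhs. Qed.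

Lemma closed_cclosed (C : set X) : closed C <-> cclosed c C.
Proof.
split=> clC x xC; apply: clC.
  move=> B /c_nbhs[n nB]; have [y Cy xy] := xC n.
  by exists y; split=> //; apply: nB.
move=> n; have [|y [Cy xy]] := xC [set y | c n x y]; last by exists y.
by apply/c_nbhs; exists n.
Qed.

Lemma closed_continuity_setE (C : set X) :
  closed_continuity_set f C <-> continuity_set c f C.
Proof.
rewrite /closed_continuity_set /continuity_set /= closed_cclosed subspace_continuousP.
split=> -[clC fC]; split=> // x.
  move=> m Cx; have : nbhs (f x) [set y' : baire_space | mkseq y' m = mkseq (f x) m].
    by apply/nbhs_baire; exists m.
  move=> /(fC x Cx); rewrite /within /= /nbhs /= => /c_nbhs[n nP].
  by exists n => y Cy xy; apply: nP.
move=> Cx S /nbhs_baire[m mS]; apply/c_nbhs; have [n nP] := fC x m Cx.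
by exists n => y xy Cy; apply/mS/nP.
Qed.

Lemma continuity_idealE (A : set X) : continuity_ideal f A <-> small c f A.
Proof.
by split=> -[C CP AC]; exists C => // n; apply/closed_continuity_setE.
Qed.

Lemma baire_class1_cylinder : baire_class1 f -> forall s : seq nat,
  exists C : nat -> set X, (forall n, cclosed c (C n)) /\
  forall x, mkseq (f x) (size s) = s <-> exists n, C n x.
Proof.
move=> f1 s; have [|C clC fC] := f1 [set y : baire_space | mkseq y (size s) = s].
  rewrite openE => y ys; apply/nbhs_baire; exists (size s) => y' y'y.
  by rewrite /= y'y.
exists C; split=> [n|x]; first exact/closed_cclosed.
have -> : (mkseq (f x) (size s) = s) = (\bigcup_n C n) x by rewrite -fC.
by split=> -[n]; exists n.
Qed.

End Bridge.

(** * Borel images, antichains and the equivalence *)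

Section BorelImage.
Context (X : topologicalType) (c : nat -> X -> X -> Prop) (f : X -> baire_space).
Hypotheses (cC : closeness c) (c_nbhs : compatible c) (f1 : baire_class1 f).

(** Closed sets of the graph topology are Borel: membership in the image means
    being, for each [n], in its [n]-neighbourhood for that topology. Only the
    initial segment of length [n] of the value of [f] matters, which leaves a
    countable union. The interiors avoid a discussion of the openness of balls. *)
Lemma embedding_image_borel h T : miller_embedding c f h ->
  <<s @open X >> (h @` body T).
Proof.
move=> hP; have := @sub_sigma_algebra X setT (@open X).
have := smallest_sigma_algebra setT (@open X).
move: <<s @open X >> => borel [borel0 borelD borelU] borel_open.
have borelC A : borel A -> borel (~` A) by rewrite -setTD; apply: borelD.
have borelI (A : nat -> set X) : (forall n, borel (A n)) -> borel (\bigcap_n A n).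
  move=> BA; rewrite -(setCK (\bigcap_n A n)) setC_bigcap.
  by apply/borelC/borelU => n; apply: borelC.
pose level n (v : seq nat) := [set x | mkseq (f x) n = v].
have borel_level n v : borel (level n v).
  have [|C clC fC] := f1 (U := [set y : baire_space | mkseq y n = v]).
    rewrite openE => y yv; apply/nbhs_baire; exists n => y' y'y.
    by rewrite /= y'y.
  rewrite (_ : level n v = \bigcup_n C n); last by rewrite -fC.
  apply: borelU => k; rewrite -(setCK (C k)); apply/borelC/borel_open.
  exact: closed_openC.
pose near n v := [set x | exists a, [/\ body T a, mkseq (f (h a)) n = v & c n x (h a)]].
pose A n v := level n v `&` interior (near n v).
have borelA n v : borel (A n v).
  rewrite (_ : A n v = \bigcap_k (if k is 0 then level n v else interior (near n v))).
    by apply: borelI => -[|_] //; apply/borel_open/open_interior.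
  apply/seteqP; split=> [x [xl xn] [|k] _ //|x xA].
  by split; [exact: (xA 0)|exact: (xA 1)].
rewrite (_ : h @` body T = \bigcap_n \bigcup_k
    (if unpickle k is Some v then A n v else set0)).
  by apply: borelI => n; apply: borelU => k; case: unpickle.
apply/seteqP; split=> x.
  move=> [a Ta <-] n _; exists (pickle (mkseq (f (h a)) n)) => //.
  rewrite pickleK; split=> //; apply/c_nbhs; exists n => y xy.
  by exists a; split=> //; case: cC => _ + _ _; apply.
move=> xA; apply: (image_graph_closed cC hP (@body_closed T)) => n.
have [k _] := xA n Logic.I; case: unpickle => // v [xv /interior_subset[a [Ta av xa]]].
by exists a => //; split=> //; rewrite av -xv.
Qed.

End BorelImage.

Lemma maximal_antichain (A : Type) (S : set A) (compat : A -> A -> Prop) :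
  (forall a, S a -> compat a a) -> (forall a b, compat a b -> compat b a) ->
  exists H : set A, [/\ H `<=` S,
    (forall a b, H a -> H b -> compat a b -> a = b) &
    (forall a, S a -> exists2 b, H b & compat a b)].
Proof.
move=> compatxx compatC.
pose anti (H : set A) := H `<=` S /\ forall a b, H a -> H b -> compat a b -> a = b.
have [F Fanti Ftot|H [[HS Hanti] Hmax]] := @Zorn_bigcup _ anti.
  split; first by move=> a [H FH Ha]; apply: (Fanti H FH).1.
  move=> a b [H FH Ha] [H' FH' Hb].
  have [HH'|H'H] := Ftot _ _ FH FH'.
    by apply: (Fanti H' FH').2 => //; apply: HH'.
  by apply: (Fanti H FH).2 => //; apply: H'H.
exists H; split=> // a Sa; apply: contrapT => nocompat.
apply: (Hmax (a |` H)).
  split; first by move=> b Hb; right.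
  by move=> aH; apply: nocompat; exists a; [apply: aH; left|exact: compatxx].
split; first by move=> b [->//|/HS].
move=> b b' [->|Hb] [->|Hb'] //; last exact: Hanti.
  by move=> ab; case: nocompat; exists b'.
by move=> /compatC ab; case: nocompat; exists b.
Qed.

Section Code.
Context (X : Type) (c : nat -> X -> X -> Prop) (q : nat -> X).
Hypothesis cC : closeness c.
Hypothesis q_dense : forall x n, exists i, c n x (q i).

(** The trace of [h] on the eventually zero sequences determines [h] by
    continuity, so there are at most continuum many Miller embeddings. *)
Definition code (h : (nat -> nat) -> X) : nat -> bool := fun k =>
  if unpickle k is Some (s, (i, n)) then `[< c n (h (nth 0 (s : seq nat))) (q i) >]
  else false.

Lemma code_inj f h h' : miller_embedding c f h -> miller_embedding c f h' ->
  code h = code h' -> h = h'.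
Proof.
have [_ c_sym c_tri c_sep] := cC.
move=> [_ hcont _ _] [_ h'cont _ _] hh'; apply/funext => a; apply: (c_sep) => n.
have [k kP] := hcont a n.+1; have [k' k'P] := h'cont a n.+1.
pose s := mkseq a (maxn k k').
have sa l : l <= maxn k k' -> mkseq (nth 0 s) l = mkseq a l.
  move=> lk; apply/agreeP => i il; rewrite nth_mkseq //; exact: leq_trans il lk.
have hs : h (nth 0 s) = h' (nth 0 s).
  apply: c_sep => m; have [i hi] := q_dense (h (nth 0 s)) m.+1.
  have := congr1 (fun x : nat -> bool => x (pickle (s, (i, m.+1)))) hh'.
  rewrite /code pickleK => /esym; rewrite (asboolT hi) => /asboolP h'i.
  exact: c_tri hi (c_sym _ _ _ h'i).
apply: (c_tri _ _ (h (nth 0 s))); first by apply: kP; apply: sa; apply: leq_maxl.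
by rewrite hs; apply: c_sym; apply: k'P; apply: sa; apply: leq_maxr.
Qed.

End Code.

Theorem corollary8p10 (R : realType) (X : topologicalType)
    (f : X -> baire_space) :
  polish R X -> baire_class1 f -> ~ piecewise_continuous f ->
  forcing_equivalent (ideal_forcing (continuity_ideal f)) miller_forcing.
Proof.
move=> polX f1 npc.
have [x0 _] : exists x : X, True.
  apply: contrapT => empty; apply: npc; exists (fun=> set0) => [n|].
    split; first exact: closed0.
    by apply/subspace_continuousP => x [].
  by apply/seteqP; split=> x // _; case: empty; exists x.
have [c [q [cC c_nbhs q_dense c_complete]]] := polish_closeness x0 polX.
pose P := ideal_forcing (continuity_ideal f).
pose emb := miller_embedding c f.
have P_emb B : P B -> exists2 h, emb h & range h `<=` B.
  move=> [borelB posB]; apply: parametrized_embedding => //; last first.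
    by move=> /(continuity_idealE f c_nbhs).
  apply: (parametrized_measurable cC q_dense c_complete _ _ borelB).
    exact: baire_class1_cylinder.
  exact: open_closeness.
have emb_P h T : emb h -> superperfect_tree T -> P (h @` body T).
  move=> hP spT; split; first exact: (embedding_image_borel cC c_nbhs f1).
  by move=> /(continuity_idealE f c_nbhs); exact: (superperfect_image_not_small cC hP spT).
pose compat (h h' : (nat -> nat) -> X) :=
  exists h'', [/\ emb h'', range h'' `<=` range h & range h'' `<=` range h'].
have [|h h' [h'' [? ? ?]]|H [Hemb Hanti Hmax]] := @maximal_antichain _ emb compat.
- by move=> h hP; exists h; split=> //; exact: subset_refl.
- by exists h''.
(* A condition below two members of the antichain contains the range of an
   embedding, which witnesses that they are compatible. *)
have H_eq h h' T B : H h -> H h' -> superperfect_tree T -> B `<=` range h' ->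
    h @` body T `<=` B -> h = h'.
  move=> Hh Hh' spT Bh' TB; apply: Hanti => //.
  have [h'' h''P sub] := P_emb _ (emb_P h T (Hemb h Hh) spT).
  exists h''; split=> //.
    by apply: subset_trans sub _ => _ [a _ <-]; exists a.
  exact: subset_trans sub (subset_trans TB Bh').
have PT : P setT.
  split.
    have [b0 bC _] := smallest_sigma_algebra setT (@open X).
    by have := bC _ b0; rewrite setD0.
  move=> [C CP CT]; apply: npc; exists C => //.
  by apply/seteqP; split.
have [h1 h1P _] := P_emb _ PT.
have [h0 Hh0 _] := Hmax _ h1P.
(* Conditions h @` body T with h in the antichain, indexed by the pairs (h, T);
   these are in turn copied into Miller forcing with the code of h as tint. *)
pose W := ((((nat -> nat) -> X) * set (seq nat))%type).
pose D : set W := [set w | H w.1 /\ superperfect_tree w.2].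
have range_body h T : h @` body T `<=` range (h : (nat -> nat) -> X).
  by move=> _ [a _ <-]; exists a.
apply: (@cantor_bernstein_equivalent _ _ _ _ P miller_forcing W D
  (fun w => w.1 @` body w.2) (fun w => tint (code c q w.1) w.2) (pair h0)).
- by move=> [h S] [/= /Hemb hP spS]; apply: emb_P.
- move=> B /P_emb[h hP hB]; have [h' Hh' [h'' [h''P h''h h''h']]] := Hmax h hP.
  have [T spT TB] := embedding_refine cC (Hemb _ Hh') h''P h''h'.
  exists (h', T) => //; rewrite subsetEset.
  exact: subset_trans TB (subset_trans h''h hB).
- by move=> [h S] [/= _ spS]; apply: tint_superperfect.
- by [].
- move=> [h S] [h' S'] [/= Hh spS] [/= Hh' spS']; rewrite !subsetEset.
  rewrite tint_subset //; split=> [[/code_inj hh' SS']|sub].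
    rewrite (hh' cC q_dense f (Hemb h Hh) (Hemb h' Hh')) => _ [a Sa <-].
    by exists a => // k; apply: SS'.
  have hh' := H_eq _ _ _ _ Hh Hh' spS (range_body _ _) sub; subst h'.
  split=> //; exact: (image_body_subset (Hemb h Hh) spS sub).
- move=> S S' spS spS'; rewrite !subsetEset /=; split=> [sub|SS' _ [a Sa <-]].
    exact: (image_body_subset (Hemb h0 Hh0) spS sub).
  by exists a => // k; apply: SS'.
- move=> [h S] T [/= Hh spS] spT; rewrite subsetEset => /(subset_tint spT)[S' spS' ->].
  by exists (h, S').
- move=> S [h S'] spS [/= Hh spS']; rewrite subsetEset => sub.
  have -> := H_eq _ _ _ _ Hh Hh0 spS' (range_body _ _) sub.
  by exists S'.
Qed.
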